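(* Let $K$ be a real quadratic field with ring of integers $\mathcal{O}_K$. Then there exists at least one additively indecomposable binary quadratic form over $\mathcal{O}_K$.
   Context: A binary quadratic form over $\mathcal{O}_K$ is $Q(x,y)=ax^2+bxy+cy^2$ with $a,b,c\in\mathcal{O}_K$. For $\alpha\in K$, $\alpha\succeq 0$ means $\sigma(\alpha)\geq0$ for every embedding $\sigma:K\to\mathbb{R}$. $Q$ is totally positive semi-definite if $Q(v)\succeq0$ for all $v\in K^2$, and totally positive definite if moreover $Q(v)=0$ implies $v=0$. A totally positive definite binary form $Q$ over $\mathcal{O}_K$ is additively indecomposable if it cannot be written as $Q=Q_1+Q_2$ with $Q_1,Q_2$ nonzero totally positive semi-definite binary quadratic forms over $\mathcal{O}_K$. *)

(* Defs.v *)
From mathcomp Require Import all_boot all_algebra all_field.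
From mathcomp Require Import reals.

Set Implicit Arguments.
Unset Strict Implicit.
Unset Printing Implicit Defensive.

Import GRing.Theory Num.Theory.
Local Open Scope ring_scope.

(* A quadratic field is normal over the rationals, so a single embedding
   into the reals makes every embedding real. *)
Definition real_quadratic_field (R : realType) (K : fieldExtType rat) : Prop :=
  (\dim {:K} = 2)%N /\ inhabited {rmorphism K -> R}.

Definition ring_of_integers (K : fieldExtType rat) (z : K) : Prop :=
  integralOver (intr : int -> K) z.

Definition totally_nonneg (R : realType) (K : fieldExtType rat) (z : K) : Prop :=
  forall sigma : {rmorphism K -> R}, 0 <= sigma z.

(* The form a x^2 + b x y + c y^2, given by its coefficients; equality and
   addition of forms are those of the coefficient triples, i.e. of
   polynomials in x and y. *)
Record bqf (K : fieldExtType rat) := BQF { bqf_a : K; bqf_b : K; bqf_c : K }.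

Definition bqf_eval (K : fieldExtType rat) (Q : bqf K) (x y : K) : K :=
  bqf_a Q * x ^+ 2 + bqf_b Q * x * y + bqf_c Q * y ^+ 2.

Definition bqf0 (K : fieldExtType rat) : bqf K := BQF 0 0 0.

Definition bqf_add (K : fieldExtType rat) (Q1 Q2 : bqf K) : bqf K :=
  BQF (bqf_a Q1 + bqf_a Q2) (bqf_b Q1 + bqf_b Q2) (bqf_c Q1 + bqf_c Q2).

Definition bqf_integral (K : fieldExtType rat) (Q : bqf K) : Prop :=
  [/\ ring_of_integers (bqf_a Q), ring_of_integers (bqf_b Q)
    & ring_of_integers (bqf_c Q)].

Definition tot_pos_semidef (R : realType) (K : fieldExtType rat)
    (Q : bqf K) : Prop :=
  forall x y : K, totally_nonneg R (bqf_eval Q x y).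

Definition tot_pos_def (R : realType) (K : fieldExtType rat)
    (Q : bqf K) : Prop :=
  tot_pos_semidef R Q /\
  (forall x y : K, bqf_eval Q x y = 0 -> x = 0 /\ y = 0).

Definition additively_indecomposable (R : realType) (K : fieldExtType rat)
    (Q : bqf K) : Prop :=
  [/\ bqf_integral Q, tot_pos_def R Q
    & ~ (exists Q1 Q2 : bqf K,
          [/\ Q1 <> bqf0 K, Q2 <> bqf0 K,
              bqf_integral Q1 /\ tot_pos_semidef R Q1,
              bqf_integral Q2 /\ tot_pos_semidef R Q2
            & Q = bqf_add Q1 Q2])].

(* Main.v *)
From HB Require Import structures.
Require Import Defs.
From mathcomp Require Import all_boot all_order all_algebra all_field.
From mathcomp Require Import reals.
From mathcomp Require Import ring lra.

(** The form [x^2 + x y + y^2] is additively indecomposable over every real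
quadratic field, for the same reason as over the integers.  The point is that
[1] is indecomposable among the totally nonnegative integers
([totally_nonneg_split1]): if [1 = u + v] with [u] and [v] totally nonnegative
and nonzero, then
every embedding sends [u] strictly between [0] and [1], hence so is the norm
of [u]; but this norm is a rational integer.

Suppose now that [x^2 + x y + y^2] is a sum of two semi-definite forms.  The
coefficients of [x^2] are totally nonnegative and add up to [1], so one of them
vanishes, and in that summand semi-definiteness kills the coefficient of
[x y] too ([psd_b_eq0]).  The other summand is then [x^2 + x y + c y^2] with
[c] equal to [0] or [1], for the same reason; [c = 0] is excluded by
semi-definiteness (with the roles of the variables exchanged), and [c = 1]
makes the first summand zero. *)

Set Implicit Arguments.
Unset Strict Implicit.
Unset Printing Implicit Defensive.

Import Order.TTheory GRing.Theory Num.Theory.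
Local Open Scope ring_scope.

(** A monic integral equation for [q] in [K] descends to the rationals and from
there maps to the algebraic numbers, where rational algebraic integers are
known to be integers. *)
Lemma integral_rat_int (K : fieldExtType rat) (q : rat) :
  ring_of_integers (q%:A : K) -> exists m : int, q = m%:~R.
Proof.
case=> p mon_p rt_p.
have rt_q : root (map_poly (intr : int -> rat) p) q.
  rewrite -(fmorph_root (in_alg K)) -map_poly_comp.
  by rewrite (eq_map_poly (g := intr)) // => m /=; rewrite scaler_int.
suff /intrP[m] : (ratr q : algC) \is a Num.int.
  by rewrite -ratr_int => /fmorph_inj; exists m.
apply: Cint_rat_Aint; first exact: Crat_rat.
apply: (@root_monic_Aint (map_poly (intr : int -> algC) p)).
- rewrite -(fmorph_root (ratr : rat -> algC)) -map_poly_comp in rt_q.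
  rewrite (eq_map_poly (g := intr)) // in rt_q.
  by move=> m /=; rewrite ratr_int.
- exact: monic_map.
by apply/polyOverP => i; rewrite coef_map /= intr_int.
Qed.

Lemma ring_of_integers_rmorph (K : fieldExtType rat)
    (tau : {rmorphism K -> K}) (z : K) :
  ring_of_integers z -> ring_of_integers (tau z).
Proof.
case=> p mon_p /(rmorph_root tau) rt_p; exists p => //; move: rt_p.
rewrite -map_poly_comp (eq_map_poly (g := intr)) // => m /=.
by rewrite rmorph_int.
Qed.

(** The norm of [u] is obtained as [u * tau u].  The endomorphism may depend on
[u]: the identity does for a rational [u], and otherwise [u] generates the
field, so that it can be sent to the other root of its minimal polynomial. *)
Lemma quadratic_conjugate (K : fieldExtType rat) (u : K) :
  (\dim {:K} = 2)%N ->
  exists tau : {rmorphism K -> K}, u * tau u \in 1%VS.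
Proof.
move=> dimK; have [u1 | uN1] := boolP (u \in 1%VS).
  by exists idfun; rewrite /= rpredM.
have deg_u : adjoin_degree 1 u = 2%N.
  have le2 : (adjoin_degree 1 u <= 2)%N.
    have := dim_Fadjoin 1 u; rewrite dimv1 muln1 => <-.
    by rewrite -dimK dimvS ?subvf.
  move: uN1 le2; rewrite -adjoin_deg_eq1.
  by rewrite /adjoin_degree; case: (_.-1) => [|[|]].
have gen_u : (<<1; u>> = fullv :> {vspace K})%VS.
  apply/eqP; rewrite eqEdim subvf /= dimK.
  by rewrite dim_Fadjoin deg_u dimv1.
pose p := minPoly 1 u.
have size_p : size p = 3%N by rewrite size_minPoly deg_u.
have p2 : p`_2 = 1.
  by have /monicP := monic_minPoly 1 u; rewrite lead_coefE -/p size_p.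
have hornerp z : p.[z] = p`_0 + p`_1 * z + z ^+ 2.
  by rewrite horner_coef size_p !big_ord_recl big_ord0 /= p2; ring.
have p_u : p`_0 + p`_1 * u + u ^+ 2 = 0.
  by rewrite -hornerp; apply/rootP/root_minPoly.
pose v := - p`_1 - u.
have rt_v : root (map_poly (\1%VF : 'End(K)) p) v.
  rewrite lfun1_poly; apply/rootP; rewrite hornerp -[RHS]p_u /v; ring.
have homK : kHom 1 fullv (kHomExtend 1 \1 u v).
  by rewrite -gen_u; apply: kHomExtendP (subvv _) (kHom1 _ _) rt_v.
have monK := kHom_monoid_morphism homK.
pose tau_rm := GRing.isMonoidMorphism.Build K K (kHomExtend 1 \1 u v) monK.
pose tau : {rmorphism K -> K} :=
  HB.pack (fun_of_lfun (kHomExtend 1 \1 u v)) tau_rm.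
exists tau; rewrite /= (kHomExtend_val (kHom1 1 1) rt_v).
have -> : u * v = p`_0.
  apply/eqP; rewrite -subr_eq0 -oppr_eq0 -[X in _ == X]p_u /v.
  by apply/eqP; ring.
by apply/polyOverP: 0%N; apply: minPolyOver.
Qed.

Lemma totally_nonneg_split1 (R : realType) (K : fieldExtType rat) (u v : K) :
  real_quadratic_field R K -> ring_of_integers u ->
  totally_nonneg R u -> totally_nonneg R v -> u + v = 1 -> u = 0 \/ v = 0.
Proof.
move=> [dimK [sigma]] int_u u_ge0 v_ge0 uv1.
have [-> | u_neq0] := eqVneq u 0; first by left.
have [-> | v_neq0] := eqVneq v 0; first by right.
have between (s : {rmorphism K -> R}) : 0 < s u < 1.
  have -> : u = 1 - v by rewrite -uv1 addrK.
  move: (v_ge0 s) (u_ge0 s); rewrite !le0r !fmorph_eq0.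
  rewrite (negbTE v_neq0) (negbTE u_neq0) /=.
  by rewrite -[u](addrK v) uv1 rmorphB rmorph1 => *; lra.
have [tau /vlineP[q norm_u]] := quadratic_conjugate u dimK.
have [m qm] : exists m : int, q = m%:~R.
  apply: (@integral_rat_int K); rewrite -norm_u.
  by apply: integral_mul => //; apply: ring_of_integers_rmorph.
(* the norm of u is the product of its images under two embeddings *)
have := congr1 sigma norm_u.
rewrite qm scaler_int rmorph_int rmorphM => eq_m.
have /andP[s0 s1] := between sigma.
have /andP[t0 t1] : 0 < sigma (tau u) < 1 := between (sigma \o tau).
have m_gt0 : (0 : R) < m%:~R by rewrite -eq_m mulr_gt0.
have m_lt1 : (m%:~R : R) < 1%:~R by rewrite -eq_m mulr_ilt1 // ltW.
by move: m_gt0 m_lt1; rewrite ltr0z ltr_int; case: m {qm eq_m} => [[|]|].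
Qed.

(** With [a = 0] the form is linear in [x] at [y = 1], so that for [b] nonzero
it takes the value [-1] there. *)
Lemma psd_b_eq0 (R : realType) (K : fieldExtType rat) (b c : K) :
  inhabited {rmorphism K -> R} -> tot_pos_semidef R (BQF 0 b c) -> b = 0.
Proof.
move=> [sigma] psdQ; apply/eqP/negPn/negP => b_neq0.
have := psdQ (- (c + 1) / b) 1 sigma; rewrite /bqf_eval /=.
have -> : 0 * (- (c + 1) / b) ^+ 2 + b * (- (c + 1) / b) * 1 + c * 1 ^+ 2 = -1.
  by field.
by rewrite rmorphN1 oppr_ge0 ler10.
Qed.

Lemma psd_swap (R : realType) (K : fieldExtType rat) (a b c : K) :
  tot_pos_semidef R (BQF a b c) -> tot_pos_semidef R (BQF c b a).
Proof.
move=> psdQ x y.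
have -> // : bqf_eval (BQF c b a) x y = bqf_eval (BQF a b c) y x.
by rewrite /bqf_eval /=; ring.
Qed.

Lemma psd_a_ge0 (R : realType) (K : fieldExtType rat) (a b c : K) :
  tot_pos_semidef R (BQF a b c) -> totally_nonneg R a.
Proof.
move=> psdQ; have := psdQ 1 0; rewrite /bqf_eval /=.
by rewrite mulr0 expr1n expr0n /= mulr0 !addr0 mulr1.
Qed.

Lemma psd_c_ge0 (R : realType) (K : fieldExtType rat) (a b c : K) :
  tot_pos_semidef R (BQF a b c) -> totally_nonneg R c.
Proof. by move/psd_swap/psd_a_ge0. Qed.

(** The coefficient of [y^2] in the second summand is [0] or [1]; the value [0]
would force the coefficient of [x y] there to vanish, whereas it is [1]. *)
Lemma split_a_eq0 (R : realType) (K : fieldExtType rat) (b1 c1 a2 b2 c2 : K) :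
  real_quadratic_field R K ->
  ring_of_integers c1 ->
  tot_pos_semidef R (BQF 0 b1 c1) -> tot_pos_semidef R (BQF a2 b2 c2) ->
  bqf_add (BQF 0 b1 c1) (BQF a2 b2 c2) = BQF 1 1 1 -> BQF 0 b1 c1 = bqf0 K.
Proof.
move=> hK int_c1 psd1 psd2 [_ b12 c12]; have [_ emb] := hK.
have b1_0 := psd_b_eq0 emb psd1.
move: b12; rewrite b1_0 add0r => b2_1.
have [-> //|c2_0] :=
  totally_nonneg_split1 hK int_c1 (psd_c_ge0 psd1) (psd_c_ge0 psd2) c12.
move: psd2; rewrite c2_0 => /psd_swap /(psd_b_eq0 emb) b2_0.
by move/eqP: b2_1; rewrite b2_0 eq_sym oner_eq0.
Qed.

Lemma tot_pos_def_111 (R : realType) (K : fieldExtType rat) :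
  inhabited {rmorphism K -> R} -> tot_pos_def R (BQF 1 1 1 : bqf K).
Proof.
move=> [sigma].
have evalE (s : {rmorphism K -> R}) x y : s (bqf_eval (BQF 1 1 1) x y) =
    (s x + s y / 2%:R) ^+ 2 + 3%:R / 4%:R * (s y) ^+ 2.
  by rewrite /bqf_eval /= !mul1r !rmorphD rmorphM !rmorphXn; field.
have q_gt0 : (0 : R) < 3%:R / 4%:R by lra.
have y_ge0 (t : R) : 0 <= 3%:R / 4%:R * t ^+ 2.
  by apply: mulr_ge0 (ltW q_gt0) (sqr_ge0 _).
split=> [x y s | x y Q0].
  by rewrite evalE; apply: addr_ge0 (sqr_ge0 _) (y_ge0 _).
have /eqP := evalE sigma x y; rewrite Q0 rmorph0 eq_sym.
rewrite paddr_eq0 ?sqr_ge0 // sqrf_eq0 mulf_eq0 sqrf_eq0 (gt_eqF q_gt0) /=.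
move=> /andP[/eqP sx /eqP sy0].
have sx0 : sigma x = 0 by move: sx; rewrite sy0 mul0r addr0.
by split; apply/eqP; rewrite -(fmorph_eq0 sigma) ?sx0 ?sy0.
Qed.

Theorem theorem1p3 (R : realType) (K : fieldExtType rat)
    (hK : real_quadratic_field R K) :
  exists Q : bqf K, additively_indecomposable R Q.
Proof.
exists (BQF 1 1 1); split.
- by split; apply: integral1.
- by apply: tot_pos_def_111; case: hK.
case=> -[a1 b1 c1] [[a2 b2 c2]].
case=> nz1 nz2 [[ia1 _ ic1] psd1] [[ia2 _ ic2] psd2] def_Q.
have a12 : a1 + a2 = 1 by case: def_Q.
have [a1_0|a2_0] : a1 = 0 \/ a2 = 0 :=
  totally_nonneg_split1 hK ia1 (psd_a_ge0 psd1) (psd_a_ge0 psd2) a12.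
- rewrite a1_0 in nz1 psd1 def_Q.
  by apply: nz1; apply: (split_a_eq0 hK ic1 psd1 psd2).
rewrite a2_0 in nz2 psd2 def_Q.
apply: nz2; apply: (split_a_eq0 hK ic2 psd2 psd1).
by rewrite def_Q /bqf_add /= [a1 + 0]addrC [b1 + _]addrC [c1 + _]addrC.
Qed.
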